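(* Let $\lambda>0$ and $0\le a<b<\infty$. Let $X_{\mathrm T}$ be the truncation to the interval $(a,b)$ of an exponential random variable with rate $\lambda$. Then the optimal variance proxy of $X_{\mathrm T}$ is $$\|X_{\mathrm T}\|_{\mathrm{vp}}^2=\frac{(b-a)\left(e^{\lambda b}+e^{\lambda a}\right)}{2\lambda\left(e^{\lambda b}-e^{\lambda a}\right)}-\frac{1}{\lambda^2}.$$ In particular, $X_{\mathrm T}$ is never strictly sub-Gaussian.
   Context: The truncation $X_{\mathrm T}$ to $(a,b)$ of an exponential random variable with rate $\lambda$ (mean $1/\lambda$) is a random variable with density $f_{X_{\mathrm T}}(t)=\lambda\frac{e^{-\lambda t}}{e^{-\lambda a}-e^{-\lambda b}}$ for $t\in(a,b)$ and $0$ otherwise. A real random variable $X$ is sub-Gaussian if there is $s\ge 0$ such that $\mathbb{E}[\exp(\theta(X-\mathbb{E}[X]))]\le\exp\left(\frac{s^2\theta^2}{2}\right)$ for all $\theta\in\mathbb{R}$. Any such $s^2$ is called a variance proxy of $X$; the smallest such $s^2$ is the optimal variance proxy, denoted $\|X\|_{\mathrm{vp}}^2$. One says that $X$ is strictly sub-Gaussian if $\operatorname{Var}[X]=\|X\|_{\mathrm{vp}}^2$. *)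

(* Defs.v *)
From HB Require Import structures.
From mathcomp Require Import all_boot all_order all_algebra.
From mathcomp Require Import all_classical all_reals all_analysis.

Set Implicit Arguments.
Unset Strict Implicit.
Unset Printing Implicit Defensive.

Import Order.TTheory GRing.Theory Num.Theory.
Import numFieldNormedType.Exports.

Local Open Scope classical_set_scope.
Local Open Scope ring_scope.

Section truncated_exponential.
Context {R : realType}.

Definition truncated_exponential_pdf (lambda a b : R) : R -> R :=
  (fun t => lambda * (expR (- lambda * t)
     / (expR (- lambda * a) - expR (- lambda * b)))) \_ `]a, b[.

Definition has_density d (T : measurableType d) (P : probability T R)
    (X : {RV P >-> R}) (f : R -> R) : Prop :=
  forall A, measurable A ->
    distribution P X A = (\int[lebesgue_measure]_(t in A) (f t)%:E)%E.

(* The truncation is characterized by its law; X may live on any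
   probability space. *)
Definition truncated_exponential d (T : measurableType d)
    (P : probability T R) (X : {RV P >-> R}) (lambda a b : R) : Prop :=
  has_density X (truncated_exponential_pdf lambda a b).

End truncated_exponential.

Section sub_gaussian.
Context {R : realType} d (T : measurableType d) (P : probability T R).
Implicit Types (X : {RV P >-> R}) (v : R).

(* A variance proxy is the square s ^+ 2, not s.  No integrability of X needs
   to be assumed to take [fine] of its mean: the bound at theta = 1 and
   theta = -1 already forces X to be integrable. *)
Definition variance_proxy X : set R :=
  [set v | exists s : R, [/\ 0 <= s, v = s ^+ 2 &
    forall theta : R,
      ('E_P[fun w => expR (theta * (X w - fine 'E_P[X]))]
        <= (expR (s ^+ 2 * theta ^+ 2 / 2))%:E)%E]].

Definition sub_gaussian X : Prop := exists v, variance_proxy X v.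

(* v is the least element of the set of variance proxies, which determines v
   uniquely. *)
Definition is_optimal_variance_proxy X v : Prop :=
  variance_proxy X v /\ lbound (variance_proxy X) v.

Definition strictly_sub_gaussian X : Prop :=
  sub_gaussian X /\
  exists2 v, is_optimal_variance_proxy X v & ('V_P[X] = v%:E)%E.

End sub_gaussian.

(* Main.v *)
(* Write h = (b - a) / 2, u = lambda h, and L x = coth x - 1 / x. Centering X at
   its mean gives a moment generating function equal to
   exp (theta h L u) * [sinh y / y] / [sinh u / u] with y = (theta - lambda) h.
   Put v = h^2 (L u / u). Then the bound by exp (v theta^2 / 2) says exactly that
   ln (sinh y / y) - (L u / (2 u)) y^2 is largest at y = u, which holds because
   its derivative y (L y / y - L u / u) changes sign there, x |-> L x / x being
   decreasing. At theta = 2 lambda one has y = u and the bound is an equality,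
   so no smaller proxy exists. The variance is h^2 L'(u), and L'(u) < L u / u is
   again the strict decrease of L x / x. Both reduce to
   2 sinh^2 x < x^2 + x sinh x cosh x. *)
Require Import Defs.
From mathcomp Require Import all_boot all_order all_algebra.
From mathcomp Require Import all_classical all_reals all_analysis.
From mathcomp Require Import measurable_realfun.
From mathcomp Require Import ring lra.

Import Order.TTheory GRing.Theory Num.Theory.
Import numFieldNormedType.Exports.

Local Open Scope classical_set_scope.
Local Open Scope ring_scope.

(** * Strict inequalities from the sign of a derivative *)

Lemma is_derive_ltr (R : realType) (f df : R -> R) (a b : R) : a < b ->
  (forall x, a <= x <= b -> is_derive x (1 : R) f (df x)) ->
  (forall x, a < x < b -> 0 < df x) -> f a < f b.
Proof.
move=> ab fdf df0.
have Df (x : R) : x \in `]a, b[ -> is_derive x 1 f (df x).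
  by rewrite in_itv/= => /andP[/ltW ax /ltW xb]; apply: fdf; rewrite ax.
(* The endpoint derivatives serve only for continuity. Since [df] is positive only on the open
   interval, it may vanish at an endpoint, as happens when comparing with a maximum. *)
have cf : {within `[a, b], continuous f}.
  by apply: derivable_within_continuous => x xab; apply: ex_derive; exact: fdf.
have [c] := MVT ab Df cf; rewrite in_itv/= => cab.
by rewrite -subr_gt0 => ->; rewrite mulr_gt0 ?subr_gt0 ?df0.
Qed.

(** Integrates positivity from 0. Iterating it reduces an inequality between functions vanishing at
    0 to one between their derivatives. *)
Lemma is_derive_gt0 (R : realType) (f df : R -> R) :
  (forall x, is_derive x (1 : R) f (df x)) -> f 0 = 0 ->
  (forall x, 0 < x -> 0 < df x) -> forall x, 0 < x -> 0 < f x.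
Proof.
move=> fdf f0 df0 x x0; rewrite -f0; apply: (is_derive_ltr _ _ df) => // y.
by move=> /andP[y0 _]; exact: df0.
Qed.

(** * Hyperbolic functions and the inequalities between them *)

Section hyperbolic.
Variable R : realType.
Implicit Types x y z : R.

Definition sinh x := (expR x - expR (- x)) / 2.
Definition cosh x := (expR x + expR (- x)) / 2.

Global Instance is_derive_sinh x : is_derive x 1 sinh (cosh x).
Proof.
rewrite /sinh; apply: is_derive_eq.
by rewrite /cosh /GRing.scale /=; field.
Qed.

Global Instance is_derive_cosh x : is_derive x 1 cosh (sinh x).
Proof.
rewrite /cosh; apply: is_derive_eq.
by rewrite /sinh /GRing.scale /=; field.
Qed.

Lemma sinh0 : sinh 0 = 0. Proof. by rewrite /sinh oppr0 subrr mul0r. Qed.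

Lemma cosh0 : cosh 0 = 1.
Proof. by rewrite /cosh oppr0 expR0; field. Qed.

Lemma sinhN x : sinh (- x) = - sinh x.
Proof. by rewrite /sinh opprK; field. Qed.

Lemma cosh2_sinh2 x : cosh x ^+ 2 - sinh x ^+ 2 = 1.
Proof.
have <- : expR x * expR (- x) = 1 by rewrite -expRD subrr expR0.
by rewrite /cosh /sinh; field.
Qed.

Lemma cosh_gt0 x : 0 < cosh x.
Proof. by rewrite divr_gt0// addr_gt0// expR_gt0. Qed.

Lemma sinh_gt0 x : 0 < x -> 0 < sinh x.
Proof.
by apply: (is_derive_gt0 _ _ cosh) => [|y _]; [exact: sinh0|exact: cosh_gt0].
Qed.

Lemma sinh_gt_id x : 0 < x -> x < sinh x.
Proof.
suff h y : 0 < y -> 0 < sinh y - y by move=> /h; rewrite subr_gt0.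
move: y; apply: (is_derive_gt0 _ (fun y => sinh y - y) (fun y => cosh y - 1)).
  by rewrite sinh0 subrr.
apply: (is_derive_gt0 _ (fun y => cosh y - 1) sinh); last exact: sinh_gt0.
  by move=> z; apply: is_derive_eq; rewrite subr0.
by rewrite cosh0 subrr.
Qed.

Lemma sinh_lt_id_cosh x : 0 < x -> sinh x < x * cosh x.
Proof.
suff h y : 0 < y -> 0 < y * cosh y - sinh y by move=> /h; rewrite subr_gt0.
move: y.
apply: (is_derive_gt0 _ (fun y => y * cosh y - sinh y) (fun y => y * sinh y)).
- by move=> z; apply: is_derive_eq; rewrite /GRing.scale /=; ring.
- by rewrite mul0r sinh0 subrr.
- by move=> z z0; rewrite mulr_gt0// sinh_gt0.
Qed.

(** The difference of the two sides and its first two derivatives vanish at 0; the third derivative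
    is [z * cosh z - sinh z], which is positive. *)
Lemma cosh_lt_quadratic x : 0 < x ->
  4 * cosh x < x * sinh x + x ^+ 2 + 4.
Proof.
suff h y : 0 < y -> 0 < y * sinh y + y ^+ 2 + 4 - 4 * cosh y.
  by move=> /h; rewrite subr_gt0.
pose k0 z := z * sinh z + z ^+ 2 + 4 - 4 * cosh z.
pose k1 z := z * cosh z + 2 * z - 3 * sinh z.
pose k2 z := z * sinh z + 2 - 2 * cosh z.
pose k3 z := z * cosh z - sinh z.
have dk0 z : is_derive z 1 k0 (k1 z).
  by apply: is_derive_eq; rewrite /k1 /GRing.scale /=; ring.
have dk1 z : is_derive z 1 k1 (k2 z).
  by apply: is_derive_eq; rewrite /k2 /GRing.scale /=; ring.
have dk2 z : is_derive z 1 k2 (k3 z).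
  by apply: is_derive_eq; rewrite /k3 /GRing.scale /=; ring.
move: y; apply: (is_derive_gt0 _ k0 k1) => //.
  by rewrite /k0 sinh0 cosh0; ring.
apply: (is_derive_gt0 _ k1 k2) => //; first by rewrite /k1 sinh0; ring.
apply: (is_derive_gt0 _ k2 k3) => //.
  by rewrite /k2 sinh0 cosh0; ring.
by move=> z z0; rewrite subr_gt0 sinh_lt_id_cosh.
Qed.

(* [(coth x - 1 / x) / x] *)
Definition langevin_ratio x := (x * cosh x - sinh x) / (x ^+ 2 * sinh x).

Lemma langevin_ratio_gt0 x : 0 < x -> 0 < langevin_ratio x.
Proof.
move=> x0; rewrite divr_gt0 ?subr_gt0 ?sinh_lt_id_cosh//.
by rewrite mulr_gt0 ?exprn_gt0 ?sinh_gt0.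
Qed.

Lemma sinhD x y : sinh (x + y) = sinh x * cosh y + cosh x * sinh y.
Proof. by rewrite /sinh /cosh opprD !expRD; field. Qed.

Lemma coshD x y : cosh (x + y) = cosh x * cosh y + sinh x * sinh y.
Proof. by rewrite /sinh /cosh opprD !expRD; field. Qed.

(** This is [cosh_lt_quadratic] at [2 x], rewritten by the double-angle formulas and divided by
    4. *)
Lemma sinh_sqr_lt x : 0 < x ->
  2 * sinh x ^+ 2 < x ^+ 2 + x * sinh x * cosh x.
Proof.
move=> x0; have := cosh_lt_quadratic (x + x); rewrite addr_gt0// => /(_ isT).
by rewrite sinhD coshD; have := cosh2_sinh2 x; nra.
Qed.

Lemma langevin_ratio_decr x y : 0 < x -> x < y ->
  langevin_ratio y < langevin_ratio x.
Proof.
move=> x0 xy; rewrite -ltrN2.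
pose df z := (z ^+ 2 + z * sinh z * cosh z - 2 * sinh z ^+ 2)
             / (z ^+ 3 * sinh z ^+ 2).
apply: (is_derive_ltr _ (fun z => - langevin_ratio z) df _ _ xy)
  => z /andP[xz _].
- have z0 : 0 < z by exact: lt_le_trans xz.
  have zn0 : z != 0 by rewrite gt_eqF.
  have sn0 : sinh z != 0 by rewrite gt_eqF ?sinh_gt0.
  have q0 : z ^+ 2 * sinh z != 0 by rewrite mulf_neq0 ?expf_neq0.
  have dq : is_derive z 1 (fun z => z ^+ 2 * sinh z)
      (2 * z * sinh z + z ^+ 2 * cosh z).
    by apply: is_derive_eq; rewrite /GRing.scale /=; ring.
  have dV := @is_deriveV R (fun z => z ^+ 2 * sinh z) _ _ _ q0 dq.
  rewrite /langevin_ratio; apply: is_derive_eq.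
  rewrite /df /GRing.scale /=.
  (* The factor [cosh z ^+ 2 - sinh z ^+ 2], equal to 1, makes the identity purely rational in [z],
     [sinh z] and [cosh z], so that [field] proves it. *)
  transitivity ((z ^+ 2 * (cosh z ^+ 2 - sinh z ^+ 2)
      + z * sinh z * cosh z - 2 * sinh z ^+ 2) / (z ^+ 3 * sinh z ^+ 2)).
    by field; rewrite zn0 sn0.
  by rewrite cosh2_sinh2 mulr1.
- have z0 : 0 < z by exact: lt_trans xz.
  rewrite divr_gt0 ?subr_gt0 ?sinh_sqr_lt//.
  by rewrite mulr_gt0 ?exprn_gt0// sinh_gt0.
Qed.

(** After taking logarithms the claim is [f y <= f u]. By the decrease of [langevin_ratio], [f]
    increases before [u] and decreases after it. *)
Lemma sinh_div_id_le_gt0 u y : 0 < u -> 0 < y ->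
  sinh y / y <= sinh u / u * expR (langevin_ratio u / 2 * (y ^+ 2 - u ^+ 2)).
Proof.
move=> u0 y0.
pose f z := ln (sinh z) - ln z - langevin_ratio u / 2 * z ^+ 2.
pose df z := z * (langevin_ratio z - langevin_ratio u).
have dfE z : 0 < z -> is_derive z 1 f (df z).
  move=> z0; have sz0 := sinh_gt0 _ z0.
  have dln := is_derive1_ln z0.
  have dlns : is_derive z 1 (@ln R \o sinh) ((sinh z)^-1 * cosh z).
    by apply: is_derive1_comp; exact: is_derive1_ln.
  rewrite /f; apply: is_derive_eq.
  rewrite /df {2}/langevin_ratio /GRing.scale /=.
  by field; rewrite !gt_eqF.
suff : f y <= f u.
  have lnE z : 0 < z -> sinh z / z = expR (ln (sinh z) - ln z).
    by move=> z0; rewrite expRD expRN !lnK ?posrE ?sinh_gt0.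
  rewrite !lnE// -expRD ler_expR /f => fyu.
  by rewrite mulrBr; lra.
have [yu|uy|->//] := ltgtP y u.
- apply: ltW; apply: (is_derive_ltr _ f df _ _ yu) => z /andP[yz zu].
  + by apply: dfE; exact: lt_le_trans yz.
  + have z0 := lt_trans y0 yz.
    by rewrite /df mulr_gt0// subr_gt0 langevin_ratio_decr.
- rewrite -lerN2; apply: ltW.
  apply: (is_derive_ltr _ (- f) (- df) _ _ uy) => z /andP[uz zy].
  + have := dfE z (lt_le_trans u0 uz).
    by move=> ?; apply: is_deriveN.
  + have z0 := lt_trans u0 uz.
    by rewrite oppr_gt0 pmulr_rlt0// subr_lt0 langevin_ratio_decr.
Qed.

(* If the right-hand side A were below 1, the previous bound would contradict
   y < sinh y at the point y where A exp (k y^2) = 1. *)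
Lemma one_le_sinh_div_id u : 0 < u ->
  1 <= sinh u / u * expR (langevin_ratio u / 2 * - u ^+ 2).
Proof.
move=> u0; set k := langevin_ratio u / 2; set A := _ * _.
have k0 : 0 < k by rewrite divr_gt0 ?langevin_ratio_gt0.
have A0 : 0 < A by rewrite mulr_gt0 ?expR_gt0// divr_gt0// sinh_gt0.
rewrite leNgt; apply/negP => A1.
have y0 : 0 < Num.sqrt (- ln A / k).
  by rewrite sqrtr_gt0 divr_gt0// oppr_gt0 ln_lt0// A0.
have := sinh_div_id_le_gt0 _ _ u0 y0; set y := Num.sqrt _ in y0 *.
rewrite -/k mulrDr expRD [expR _ * expR _]mulrC mulrA -/A.
rewrite sqr_sqrtr; last by rewrite ltW// -sqrtr_gt0.
rewrite mulrCA divff ?gt_eqF// mulr1 expRN lnK ?posrE// divff ?gt_eqF//.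
by rewrite leNgt ltr_pdivlMr// mul1r sinh_gt_id.
Qed.

(** The value 1 at 0 is the continuous extension of [sinh x / x]; it is attained in the moment
    generating function at [theta = lambda]. *)
Definition sinhc x := if x == 0 then 1 else sinh x / x.

Lemma sinhcN x : sinhc (- x) = sinhc x.
Proof. by rewrite /sinhc oppr_eq0 sinhN invrN mulrNN. Qed.

Lemma sinhc_gt0 x : 0 < x -> 0 < sinhc x.
Proof. by move=> x0; rewrite /sinhc gt_eqF// divr_gt0// sinh_gt0. Qed.

(** Both sides are even in [y], so it suffices to combine the cases [y = 0] and [0 < y]. *)
Lemma sinhc_le u y : 0 < u ->
  sinhc y <= sinhc u * expR (langevin_ratio u / 2 * (y ^+ 2 - u ^+ 2)).
Proof.
move=> u0; wlog y_ge0 : y / 0 <= y.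
  have [y0 ->//|/ltW y0] := leP 0 y.
  by move=> /(_ (- y)); rewrite oppr_ge0 sinhcN sqrrN; exact.
rewrite /sinhc (gt_eqF u0); case: eqVneq => [->|yn0].
  by rewrite expr0n sub0r one_le_sinh_div_id.
by rewrite sinh_div_id_le_gt0// lt_neqAle eq_sym yn0.
Qed.

Lemma expR_cosh_sinh x : expR x = cosh x + sinh x.
Proof. by rewrite /cosh /sinh; field. Qed.

Lemma expRN_cosh_sinh x : expR (- x) = cosh x - sinh x.
Proof. by rewrite /cosh /sinh; field. Qed.

End hyperbolic.

Arguments sinh {R} x.
Arguments cosh {R} x.
Arguments langevin_ratio {R} x.
Arguments sinhc {R} x.

(** * Expectation of a function of [X] as an integral against a density *)

(* This is not phrased with [distribution P X] because, on R, that measure and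
   [lebesgue_measure] are attached to different displays. *)
Section integral_density.
Local Open Scope ereal_scope.
Context d d' (T : measurableType d) (T' : measurableType d') (R : realType).
Variables (P : {measure set T -> \bar R}) (mu : {measure set T' -> \bar R}).
Variables (X : T -> T') (f : T' -> R).
Hypotheses (mX : measurable_fun setT X) (mf : measurable_fun setT f).
Hypothesis f_ge0 : forall x, (0 <= f x)%R.
Hypothesis density : forall A, measurable A ->
  P (X @^-1` A) = \int[mu]_(x in A) (f x)%:E.

Import HBNNSimple.

(** A simple function is a finite combination of indicators of its fibres, and on indicators the
    claim is the hypothesis [density]. *)
Lemma integral_density_nnsfun (h : {nnsfun T' >-> R}) :
  \int[P]_w (h (X w))%:E = \int[mu]_x ((h x)%:E * (f x)%:E).
Proof.
have mfE : measurable_fun setT (fun x => (f x)%:E) by exact/measurable_EFinP.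
under eq_integral do rewrite fimfunE -fsumEFin//.
rewrite ge0_integral_fsum//; last 2 first.
- move=> r; apply/measurable_EFinP; apply: measurable_funM => //.
  exact: measurableT_comp.
- by move=> r w _; exact: nnfun_muleindic_ge0.
transitivity (\int[mu]_x (\sum_(r \in range h)
    (r * \1_(h @^-1` [set r]) x)%:E * (f x)%:E)); last first.
  apply: eq_integral => x _; rewrite -ge0_mule_fsuml.
    by rewrite fsumEFin// -fimfunE.
  by move=> r; exact: nnfun_muleindic_ge0.
rewrite ge0_integral_fsum//; last 2 first.
- move=> r; apply: emeasurable_funM => //.
  exact/measurable_EFinP/measurableT_comp.
- by move=> r x _; rewrite mule_ge0 ?lee_fin//; exact: nnfun_muleindic_ge0.
apply: eq_fsbigr => r rh.
have mr : measurable (h @^-1` [set r]) by [].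
have mXr : measurable (X @^-1` (h @^-1` [set r])).
  by rewrite -[X in measurable X]setTI; exact: mX.
under [RHS]eq_integral do rewrite EFinM -muleA.
under eq_integral do rewrite EFinM.
(* Writing [r] as a value of [h] makes it nonnegative, as required to pull it out of the
   integrals. *)
move: rh mr mXr; rewrite inE/= => -[x _ <-{r}]; set A := _ @^-1` _ => mA mXA.
rewrite !ge0_integralZl//; last 5 first.
- apply: emeasurable_funM => //.
  exact/measurable_EFinP/measurable_indic.
- by move=> y _; rewrite mule_ge0 ?lee_fin.
- by rewrite lee_fin.
- apply/measurable_EFinP/measurableT_comp => //; exact: measurable_indic.
- by rewrite lee_fin.
congr (_ * _); transitivity (P (X @^-1` A)).
  by rewrite -[X in P X]setIT -integral_indic.
rewrite density// integral_mkcond; apply: eq_integral => y _.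
by rewrite patchE indicE; case: ifPn => _; rewrite ?mul1e ?mul0e.
Qed.

(** Monotone convergence on both sides, along simple functions increasing to [g]. *)
Lemma ge0_integral_density (g : T' -> \bar R) :
  measurable_fun setT g -> (forall x, 0 <= g x) ->
  \int[P]_w g (X w) = \int[mu]_x (g x * (f x)%:E).
Proof.
move=> mg g0.
have mfE : measurable_fun setT (fun x => (f x)%:E) by exact/measurable_EFinP.
pose h := nnsfun_approx measurableT mg.
have hg x : (EFin \o h n) x @[n --> \oo] --> g x.
  by apply: cvg_nnsfun_approx.
transitivity (lim (\int[P]_w (h n (X w))%:E @[n --> \oo])).
  rewrite -monotone_convergence//=.
  - by apply: eq_integral => w _; apply/esym/cvg_lim => //; exact: hg.
  - by move=> n; apply/measurable_EFinP; exact: measurableT_comp.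
  - by move=> n w _; rewrite lee_fin.
  - by move=> w _ m n mn; rewrite lee_fin; exact/lefP/nd_nnsfun_approx.
under eq_fun do rewrite integral_density_nnsfun.
rewrite -monotone_convergence//=.
- apply: eq_integral => x _; apply/cvg_lim => //.
  by apply: cvgeZr => //; exact: hg.
- by move=> n; apply: emeasurable_funM => //; exact/measurable_EFinP.
- by move=> n x _; rewrite mule_ge0 ?lee_fin.
- move=> x _ m n mn; rewrite lee_wpmul2r ?lee_fin//.
  exact/lefP/nd_nnsfun_approx.
Qed.

(** Since [f] is nonnegative, multiplication by [f] commutes with taking positive and negative
    parts. *)
Lemma integral_density (g : T' -> R) : measurable_fun setT g ->
  \int[P]_w (g (X w))%:E = \int[mu]_x (g x * f x)%:E.
Proof.
move=> mg.
have mgE : measurable_fun setT (fun x => (g x)%:E) by exact/measurable_EFinP.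
rewrite integralE [RHS]integralE; congr (_ - _).
- transitivity (\int[P]_w (fun x => (g x)%:E)^\+ (X w)).
    by apply: eq_integral => w _; rewrite !funeposE.
  rewrite ge0_integral_density//; last exact: measurable_funepos.
  apply: eq_integral => x _.
  by rewrite !funeposE maxe_pMl ?lee_fin ?mul0e.
- transitivity (\int[P]_w (fun x => (g x)%:E)^\- (X w)).
    by apply: eq_integral => w _; rewrite !funenegE.
  rewrite ge0_integral_density//; last exact: measurable_funeneg.
  apply: eq_integral => x _.
  by rewrite !funenegE maxe_pMl ?lee_fin ?mul0e// EFinM mulNe.
Qed.

End integral_density.

(** * Expectations under the truncated law from antiderivatives *)

Section truncated_expectation.
Context (R : realType) d (T : measurableType d) (P : probability T R).
Variables (X : {RV P >-> R}) (lambda a b : R).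
Hypotheses (lambda_gt0 : 0 < lambda) (a_lt_b : a < b).
Hypothesis X_truncated : truncated_exponential X lambda a b.

Lemma expR_diff_gt0 : 0 < expR (- lambda * a) - expR (- lambda * b).
Proof. by rewrite subr_gt0 ltr_expR !mulNr ltrN2 ltr_pM2l. Qed.

(** [G] is an antiderivative of [g] times the untruncated density, so the fundamental theorem of
    calculus applies once the normalising constant is divided out. *)
Lemma truncated_expectation (g G : R -> R) :
  continuous g ->
  (forall t, is_derive t (1 : R) G (g t * (lambda * expR (- lambda * t)))) ->
  'E_P[g \o X]%E =
  ((G b - G a) / (expR (- lambda * a) - expR (- lambda * b)))%:E.
Proof.
move=> cg dG; set D := expR _ - expR _.
have D_gt0 : 0 < D := expR_diff_gt0.
pose p t := lambda * (expR (- lambda * t) / D).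
have p_ge0 t : 0 <= p t.
  by rewrite !mulr_ge0 ?invr_ge0 ?expR_ge0 ?ltW.
have cp : continuous p.
  move=> t; apply: cvgM; first exact: cvg_cst.
  apply: cvgM; last exact: cvg_cst.
  apply: continuous_comp; last exact: continuous_expR.
  by apply: cvgM; [exact: cvg_cst|exact: cvg_id].
have cgp : continuous (fun t => g t * p t).
  by move=> t; apply: cvgM; [exact: cg|exact: cp].
have mg : measurable_fun setT g by exact: continuous_measurable_fun.
pose f := truncated_exponential_pdf lambda a b.
have fE : f = p \_ `]a, b[ by [].
have mf : measurable_fun setT f.
  rewrite fE; apply/measurable_restrict => //.
  by apply: measurable_funTS; exact: continuous_measurable_fun.
have f_ge0 t : 0 <= f t by rewrite fE; apply: restrict_ge0.
have mX : measurable_fun [set: T] (X : T -> measurableTypeR R).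
  exact: (@measurable_funPT _ _ _ _ X).
rewrite unlock.
rewrite (@integral_density _ _ T (measurableTypeR R) R P lebesgue_measure
  X f)//.
transitivity (\int[lebesgue_measure]_(t in `]a, b[) (g t * p t)%:E)%E.
  rewrite [RHS]integral_mkcond; apply: eq_integral => t _.
  by rewrite fE !patchE; case: ifPn => // _; rewrite mulr0.
(* Adding the two endpoints leaves the integral unchanged and gives the closed interval on which the
   fundamental theorem is stated. *)
rewrite -(@integral_itv_bndoo R a b _ true false)//; last first.
  apply/measurable_EFinP/measurable_funTS.
  exact: continuous_measurable_fun.
have dGD t : is_derive t (1 : R) (fun t => G t / D) (g t * p t).
  by apply: is_derive_eq; rewrite /p /GRing.scale /=; ring.
have cGD : continuous (fun t => G t / D).
  by move=> t; apply/differentiable_continuous/derivable1_diffP/ex_derive.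
rewrite (@continuous_FTC2 _ _ (fun t => G t / D))//.
- by rewrite -EFinB mulrBl.
- exact: continuous_subspaceT.
- split.
  + by move=> t _; exact: ex_derive.
  + exact/cvg_at_right_filter/cGD.
  + exact/cvg_at_left_filter/cGD.
- by move=> t _; rewrite derive1E derive_val.
Qed.

End truncated_expectation.

(** * Mean, moment generating function and variance of [X] *)

Section truncated_exponential_moments.
Context (R : realType) d (T : measurableType d) (P : probability T R).
Variables (X : {RV P >-> R}) (lambda a b : R).
Hypotheses (lambda_gt0 : 0 < lambda) (a_lt_b : a < b).
Hypothesis X_truncated : truncated_exponential X lambda a b.

Let h := (b - a) / 2.
Let c := (a + b) / 2.
Let u := lambda * h.

Let h_gt0 : 0 < h. Proof. by rewrite divr_gt0 ?subr_gt0. Qed.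
Let u_gt0 : 0 < u. Proof. exact: mulr_gt0. Qed.
Let sinh_u_gt0 : 0 < sinh u. Proof. exact: sinh_gt0. Qed.
Let aE : a = c - h. Proof. by rewrite /c /h; field. Qed.
Let bE : b = c + h. Proof. by rewrite /c /h; field. Qed.

(** Factoring out the exponential at the midpoint [c] turns the normalising constant into
    [2 * expR (- lambda * c) * sinh u]. *)
Let expR_a : expR (- lambda * a) = expR (- lambda * c) * (cosh u + sinh u).
Proof. by rewrite -expR_cosh_sinh -expRD {1}aE /u; congr expR; ring. Qed.

Let expR_b : expR (- lambda * b) = expR (- lambda * c) * (cosh u - sinh u).
Proof. by rewrite -expRN_cosh_sinh -expRD {1}bE /u; congr expR; ring. Qed.

Let lambda_neq0 : lambda != 0. Proof. by rewrite gt_eqF. Qed.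
Let sinh_neq0 : sinh u != 0. Proof. by rewrite gt_eqF. Qed.
Let expR_neq0 x : expR x != 0 :> R. Proof. by rewrite gt_eqF ?expR_gt0. Qed.

Let expectationE (g G : R -> R) : continuous g ->
  (forall t, is_derive t (1 : R) G (g t * (lambda * expR (- lambda * t)))) ->
  'E_P[g \o X]%E = ((G b - G a) / (2 * expR (- lambda * c) * sinh u))%:E.
Proof.
move=> cg dG.
rewrite (truncated_expectation _ _ _ _ _ _ _ _ lambda_gt0 a_lt_b X_truncated
  g G cg dG) expR_a expR_b.
by congr (_ / _)%:E; ring.
Qed.

Lemma truncated_mean : 'E_P[X]%E = (c + lambda^-1 - h * cosh u / sinh u)%:E.
Proof.
pose G t := - (t + lambda^-1) * expR (- lambda * t).
have dG (t : R) : is_derive t 1 G (t * (lambda * expR (- lambda * t))).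
  apply: is_derive_eq; rewrite /GRing.scale /=.
  by field.
have cid : continuous (@id R) by move=> t; exact: cvg_id.
rewrite (expectationE id G cid dG); congr EFin.
rewrite /G expR_a expR_b aE bE.
by field; rewrite lambda_neq0 sinh_neq0 expR_neq0.
Qed.

(** The integrand is proportional to the exponential of [(theta - lambda) * t], whose mean over an
    interval of half-length [h] centred at [c] is its value at [c] times
    [sinhc ((theta - lambda) * h)]. *)
Lemma truncated_mgf (m theta : R) :
  'E_P[fun w => expR (theta * (X w - m))]%E =
  (expR (theta * (c - m)) * sinhc ((theta - lambda) * h) / sinhc u)%:E.
Proof.
rewrite [sinhc u]/sinhc (gt_eqF u_gt0).
pose g t := expR (theta * (t - m)).
have cg : continuous g.
  move=> t; apply: continuous_comp; last exact: continuous_expR.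
  by apply: cvgM; [exact: cvg_cst|apply: cvgB; [exact: cvg_id|exact: cvg_cst]].
have expR_m : expR (theta * (c - m) - lambda * c) =
    expR (theta * (c - m)) * expR (- lambda * c).
  by rewrite -expRD mulNr.
have [thetaE|thetaN] := eqVneq theta lambda.
  (* Here the two exponentials in [t] cancel: the integrand is constant and its antiderivative
     linear. *)
  pose G t := lambda * expR (- lambda * m) * t.
  have dG (t : R) : is_derive t 1 G (g t * (lambda * expR (- lambda * t))).
    have -> : g t * (lambda * expR (- lambda * t)) =
        lambda * expR (- lambda * m).
      by rewrite /g thetaE mulrCA -expRD; congr (_ * expR _); ring.
    by apply: is_derive_eq; rewrite /GRing.scale /= mulr1.
  rewrite (expectationE g G cg dG); congr EFin.
  have expR_mE : expR (- lambda * m) =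
      expR (theta * (c - m)) * expR (- lambda * c).
    by rewrite -expR_m thetaE; congr expR; ring.
  rewrite /G thetaE subrr mul0r /sinhc eqxx expR_mE thetaE aE bE /u.
  by field; rewrite lambda_neq0 sinh_neq0 expR_neq0 gt_eqF.
pose G t := lambda / (theta - lambda) * expR (theta * (t - m) - lambda * t).
have dG (t : R) : is_derive t 1 G (g t * (lambda * expR (- lambda * t))).
  apply: is_derive_eq; rewrite /GRing.scale /= expRD -mulNr /g.
  by field; rewrite subr_eq0.
rewrite (expectationE g G cg dG); congr EFin.
have yn0 : (theta - lambda) * h != 0.
  by rewrite mulf_neq0 ?subr_eq0// gt_eqF.
rewrite /sinhc (negbTE yn0) /G aE bE.
set y := _ * h in yn0 *.
have -> : theta * (c + h - m) - lambda * (c + h) =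
    theta * (c - m) - lambda * c + y by rewrite /y; ring.
have -> : theta * (c - h - m) - lambda * (c - h) =
    theta * (c - m) - lambda * c - y by rewrite /y; ring.
rewrite !(expRD (_ - _ * c)) expR_m (expR_cosh_sinh _ y) (expRN_cosh_sinh _ y).
(* Naming [sinh y] first keeps it an atom for [field] when [y] is unfolded. *)
set sy := sinh y; rewrite /y /u.
by field; rewrite lambda_neq0 sinh_neq0 subr_eq0 thetaN expR_neq0 gt_eqF.
Qed.

(** With [L x = coth x - 1 / x] and [h / u = 1 / lambda], this value is [h^2 L'(u)]. *)
Lemma truncated_variance :
  'V_P[X]%E = (lambda ^- 2 - h ^+ 2 / sinh u ^+ 2)%:E.
Proof.
rewrite /variance unlock truncated_mean /=; set m := (X in cst X).
pose g t := (t - m) * (t - m).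
(* Obtained by integrating by parts twice. *)
pose G t := - ((t - m) ^+ 2 + 2 * (t - m) / lambda + 2 / lambda ^+ 2)
            * expR (- lambda * t).
have cg : continuous g.
  have cB : continuous (fun t : R => t - m).
    by move=> t; apply: cvgB; [exact: cvg_id|exact: cvg_cst].
  by move=> t; apply: cvgM; exact: cB.
have dG (t : R) : is_derive t 1 G (g t * (lambda * expR (- lambda * t))).
  apply: is_derive_eq; rewrite /GRing.scale /= /g.
  by field.
rewrite (expectationE g G cg dG); congr EFin.
rewrite /G expR_a expR_b.
have -> : h ^+ 2 / sinh u ^+ 2 =
    h ^+ 2 * (cosh u ^+ 2 - sinh u ^+ 2) / sinh u ^+ 2.
  by rewrite cosh2_sinh2 mulr1.
rewrite aE bE /m.
by field; rewrite lambda_neq0 sinh_neq0 expR_neq0.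
Qed.

End truncated_exponential_moments.

(** * The optimal variance proxy and its gap to the variance *)

Theorem theorem3p1 (R : realType) (d : measure_display) (T : measurableType d)
    (P : probability T R) (X : {RV P >-> R}) (lambda a b : R)
    (lambda_gt0 : 0 < lambda) (a_ge0 : 0 <= a) (a_lt_b : a < b)
    (X_truncated : truncated_exponential X lambda a b) :
  is_optimal_variance_proxy X
    ((b - a) * (expR (lambda * b) + expR (lambda * a))
       / (2 * lambda * (expR (lambda * b) - expR (lambda * a)))
     - 1 / lambda ^+ 2)
  /\ ~ strictly_sub_gaussian X.
Proof.
pose h := (b - a) / 2; pose c := (a + b) / 2; pose u := lambda * h.
have h_gt0 : 0 < h by rewrite divr_gt0 ?subr_gt0.
have u_gt0 : 0 < u by exact: mulr_gt0.
have sinh_u_gt0 : 0 < sinh u by exact: sinh_gt0.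
have lambda_neq0 : lambda != 0 by rewrite gt_eqF.
have h_neq0 : h != 0 by rewrite gt_eqF.
have sinh_neq0 : sinh u != 0 by rewrite gt_eqF.
pose v := h ^+ 2 * langevin_ratio u.
have -> : (b - a) * (expR (lambda * b) + expR (lambda * a))
       / (2 * lambda * (expR (lambda * b) - expR (lambda * a)))
     - 1 / lambda ^+ 2 = v.
  have -> : expR (lambda * a) = expR (lambda * c) * (cosh u - sinh u).
    by rewrite -expRN_cosh_sinh -expRD; congr expR; rewrite /u /c /h; field.
  have -> : expR (lambda * b) = expR (lambda * c) * (cosh u + sinh u).
    by rewrite -expR_cosh_sinh -expRD; congr expR; rewrite /u /c /h; field.
  have -> : b - a = 2 * h by rewrite /h; field.
  have e_neq0 : expR (lambda * c) != 0 by rewrite gt_eqF ?expR_gt0.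
  set e := expR _ in e_neq0 *.
  have -> : e * (cosh u + sinh u) - e * (cosh u - sinh u) = 2 * e * sinh u.
    by ring.
  rewrite /v /langevin_ratio; set s := sinh u in sinh_neq0 *; rewrite /u.
  by field; rewrite sinh_neq0 h_neq0 lambda_neq0 e_neq0.
set m := fine 'E_P[X].
(* [u * langevin_ratio u] is [L u]: the mean lies [h * L u] to the left of the midpoint. *)
have mE : c - m = h * u * langevin_ratio u.
  rewrite /m (truncated_mean _ _ _ _ _ _ _ _ lambda_gt0 a_lt_b X_truncated).
  rewrite /= -/h -/c -/u /langevin_ratio.
  set s := sinh u in sinh_neq0 *; rewrite /u.
  by field; rewrite lambda_neq0 h_neq0 sinh_neq0.
have mgfE theta := truncated_mgf _ _ _ _ X lambda a b lambda_gt0 a_lt_b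
  X_truncated m theta.
rewrite -/h -/c -/u mE in mgfE.
have v_gt0 : 0 < v by rewrite mulr_gt0 ?exprn_gt0 ?langevin_ratio_gt0.
have sinhc_u_gt0 := sinhc_gt0 _ _ u_gt0.
have optimal : is_optimal_variance_proxy X v.
  split.
    exists (Num.sqrt v); rewrite sqr_sqrtr; last exact: ltW.
    split=> // theta; rewrite mgfE lee_fin ler_pdivrMr//.
    (* Here [y ^+ 2 - u ^+ 2 = h ^+ 2 * (theta ^+ 2 - 2 * theta * lambda)]. Its term linear in
       [theta] cancels the factor coming from the mean, leaving exactly [v * theta ^+ 2 / 2]. *)
    have := sinhc_le _ u ((theta - lambda) * h) u_gt0.
    rewrite -(ler_pM2l (expR_gt0 (theta * (h * u * langevin_ratio u)))).
    move=> /le_trans; apply; rewrite mulrCA -expRD mulrC le_eqVlt.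
    by apply/orP; left; apply/eqP; congr (expR _ * _); rewrite /v /u; field.
  (* At [theta = 2 * lambda] the two [sinhc] factors cancel and the remaining exponent is
     [v * theta ^+ 2 / 2], which forces [v <= s ^+ 2]. *)
  move=> w [s [_ -> /(_ (2 * lambda))]].
  rewrite mgfE.
  have -> : (2 * lambda - lambda) * h = u by rewrite /u; ring.
  rewrite mulfK ?gt_eqF// lee_fin ler_expR.
  have -> : 2 * lambda * (h * u * langevin_ratio u) = v * (2 * lambda ^+ 2).
    by rewrite /v /u; ring.
  have -> : s ^+ 2 * (2 * lambda) ^+ 2 / 2 = s ^+ 2 * (2 * lambda ^+ 2).
    by field.
  by rewrite ler_pM2r// mulr_gt0// exprn_gt0.
split=> // -[_ [w [w_proxy w_min]]].
have -> : w = v.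
  apply/eqP; rewrite eq_le w_min ?optimal.2//; exact: optimal.1.
rewrite (truncated_variance _ _ _ _ _ _ _ _ lambda_gt0 a_lt_b X_truncated).
rewrite -/h -/u => -[]; apply/eqP; rewrite lt_eqF// -subr_gt0.
(* Over a common denominator, the gap between proxy and variance has as a factor the difference of
   the two sides of [sinh_sqr_lt]. *)
suff -> : v - (lambda ^- 2 - h ^+ 2 / sinh u ^+ 2) =
    (u ^+ 2 + u * sinh u * cosh u - 2 * sinh u ^+ 2) * h ^+ 2
    / (u ^+ 2 * sinh u ^+ 2).
  rewrite divr_gt0//; last by rewrite mulr_gt0 ?exprn_gt0.
  by rewrite mulr_gt0 ?exprn_gt0// subr_gt0 sinh_sqr_lt.
rewrite /v /langevin_ratio; set s := sinh u in sinh_neq0 *; rewrite /u.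
by field; rewrite lambda_neq0 h_neq0 sinh_neq0.
Qed.
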